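(* In $\mathcal{EM}^{-1}(\mathrm{R})\setminus L^{-1}(0)$, the action-angle coordinates $(A_1,A_2,\varphi_1,\varphi_2)$ satisfy the Poisson bracket relations $$\{A_j,A_k\}=\{\mathrm{e}^{-i\varphi_j},\mathrm{e}^{-i\varphi_k}\}=0,\qquad \{A_j,\mathrm{e}^{-i\varphi_k}\}=i\,\mathrm{e}^{-i\varphi_k}\,\delta_{jk},$$ for $j,k=1,2$.
   Context: Spherical pendulum: $T^*S^2\cong TS^2=\{(q,p)\in\mathbb{R}^3\times\mathbb{R}^3:\langle q,q\rangle=1,\langle q,p\rangle=0\}$ with symplectic form $\omega$ the restriction of $\sum_{i=1}^3dp_i\wedge dq_i$. $H=\tfrac12\langle p,p\rangle+q_3$, $L=q_1p_2-q_2p_1$, $\mathcal{EM}=(H,L)$, and $\mathrm{R}$ is the set of regular values of $\mathcal{EM}$ lying in its image. The actions are $A_2=L$ and $A_1=\mathcal{A}_1(H,L)$, where, for $(h,\ell)\in\mathrm{R}$, $$\mathcal{A}_1(h,\ell)=\frac1\pi\int_{x_-}^{x_+}\frac{\sqrt{2(h-x)(1-x^2)-\ell^2}}{1-x^2}\,dx,$$ with $x_-<x_+$ the consecutive roots in $[-1,1]$ of $2(h-x)(1-x^2)-\ell^2$ between which it is positive. $A_1$ is smooth on $\mathcal{EM}^{-1}(\mathrm{R})\setminus L^{-1}(0)$. The angles $\varphi_1,\varphi_2$ (defined modulo $2\pi$) are conjugate to $A_1,A_2$: $(A_1,A_2,\varphi_1,\varphi_2)$ are action-angle coordinates with $\omega=dA_1\wedge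 d\varphi_1+dA_2\wedge d\varphi_2$. The Poisson bracket is $\{f_1,f_2\}=X_{f_2}(f_1)=-X_{f_1}(f_2)=\omega(X_{f_2},X_{f_1})$, with Hamiltonian vector fields given in these coordinates by $\dot\varphi_i=\partial f/\partial A_i$, $\dot A_i=-\partial f/\partial\varphi_i$. It is extended complex-bilinearly to complex-valued functions. *)

(* Defs.v *)
From HB Require Import structures.
From mathcomp Require Import all_boot all_order all_algebra.
From mathcomp Require Import all_classical all_reals all_analysis.
From mathcomp Require Export complex.
Set Implicit Arguments.
Unset Strict Implicit.
Unset Printing Implicit Defensive.
Import Order.TTheory GRing.Theory Num.Theory numFieldNormedType.Exports.
Local Open Scope classical_set_scope.
Local Open Scope ring_scope.

Definition i1 : 'I_3 := @Ordinal 3 0 isT.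
Definition i2 : 'I_3 := @Ordinal 3 1 isT.
Definition i3 : 'I_3 := @Ordinal 3 2 isT.

Notation phase R := ('rV[R]_3 * 'rV[R]_3)%type.

Definition dot (R : realType) (u v : 'rV[R]_3) : R := \sum_i u 0 i * v 0 i.

Definition TS2 (R : realType) : set (phase R) :=
  [set m | dot m.1 m.1 = 1 /\ dot m.1 m.2 = 0].

(* The tangent space of [TS2] at [m], obtained by differentiating the two
   defining equations. *)
Definition tangent (R : realType) (m : phase R) : set (phase R) :=
  [set v | dot m.1 v.1 = 0 /\ dot v.1 m.2 + dot m.1 v.2 = 0].

Definition wedge (R : realType) (V : Type) (a b : V -> R) (u v : V) : R :=
  a u * b v - a v * b u.

(* [\sum_i dp_i /\ dq_i], to be used on tangent vectors of [TS2]. *)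
Definition omega (R : realType) (u v : phase R) : R :=
  \sum_(i < 3) wedge (fun w : phase R => w.2 0 i)
                     (fun w : phase R => w.1 0 i) u v.

(* A function on [TS2] is represented by a function on the ambient space whose
    values outside [TS2] are irrelevant. *)

Fixpoint Ck (R : realType) (k : nat) (U : set (phase R)) (F : phase R -> R)
    : Prop :=
  match k with
  | 0 => forall x, U x -> {for x, continuous F}
  | k'.+1 => (forall x, U x -> differentiable F x) /\
             (forall v, Ck k' U ('D_v F))
  end.

Definition smooth_at (R : realType) (f : phase R -> R) (m : phase R) : Prop :=
  exists (U : set (phase R)) (F : phase R -> R),
    [/\ open U, U m, forall k, Ck k U F &
        forall x, U x -> TS2 x -> F x = f x].

Definition extension_at (R : realType) (f : phase R -> R) (m : phase R)
    : set (phase R -> R) :=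
  [set F | differentiable F m /\ \forall x \near m, TS2 x -> F x = f x].

(* The differential at [m] of a function on [TS2]: that of any ambient
   extension differentiable at [m].  It is meaningful on tangent vectors only,
   where it does not depend on the extension. *)
Definition mdiff (R : realType) (f : phase R -> R) (m v : phase R) : R :=
  'd (xget (fun=> 0) (extension_at f m)) m v.

(* The sign in [omega (X_f, v) = - df v] is the one for which
   [omega = \sum_i dA_i /\ dphi_i] gives
   [dphi_i/dt = df/dA_i] and [dA_i/dt = - df/dphi_i] along [X_f]. *)
Definition hamvec (R : realType) (f : phase R -> R) (m : phase R) : phase R :=
  xget 0 [set X | tangent m X /\
                  forall v, tangent m v -> omega X v = - mdiff f m v].

Definition bracket (R : realType) (f g : phase R -> R) (m : phase R) : R :=
  mdiff f m (hamvec g m).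

Local Open Scope complex_scope.

Definition cbracket (R : realType) (f g : phase R -> R[i]) (m : phase R)
    : R[i] :=
  let ref x := complex.Re (f x) in let imf x := complex.Im (f x) in
  let reg x := complex.Re (g x) in let img x := complex.Im (g x) in
  (bracket ref reg m - bracket imf img m) +i*
  (bracket ref img m + bracket imf reg m).

Definition cexp (R : realType) (z : R[i]) : R[i] :=
  (expR (complex.Re z))%:C * (cos (complex.Im z) +i* sin (complex.Im z)).

Definition energy (R : realType) (m : phase R) : R :=
  dot m.2 m.2 / 2 + m.1 0 i3.

Definition angmom (R : realType) (m : phase R) : R :=
  m.1 0 i1 * m.2 0 i2 - m.1 0 i2 * m.2 0 i1.

(* The set R of regular values of (H, L) lying in its image. *)
Definition regular_values (R : realType) : set (R * R) :=
  [set c | (exists m, TS2 m /\ (energy m, angmom m) = c) /\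
     forall m, TS2 m -> (energy m, angmom m) = c ->
       forall a : R * R, exists v, tangent m v /\
         (mdiff (@energy R) m v, mdiff (@angmom R) m v) = a].

Definition radicand (R : realType) (h l x : R) : R :=
  2 * (h - x) * (1 - x ^+ 2) - l ^+ 2.

Definition turning_points (R : realType) (h l : R) : set (R * R) :=
  [set x | [/\ -1 <= x.1, x.1 < x.2, x.2 <= 1,
               radicand h l x.1 = 0 /\ radicand h l x.2 = 0 &
               forall y, x.1 < y < x.2 -> 0 < radicand h l y]].

(* For [(h, l)] in [regular_values] there is exactly one pair of turning
   points. *)
Definition action1 (R : realType) (h l : R) : R :=
  let x := xget (0, 0) (turning_points h l) in
  pi^-1 * Rintegral lebesgue_measure `[x.1, x.2]
            (fun y => Num.sqrt (radicand h l y) / (1 - y ^+ 2)).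

(* Indices 1, 2 of the actions and angles are [0, 1 : 'I_2]. *)
Definition action (R : realType) (k : 'I_2) (m : phase R) : R :=
  if k == 0 then action1 (energy m) (angmom m) else angmom m.

Definition domain (R : realType) : set (phase R) :=
  [set m | [/\ TS2 m, regular_values (energy m, angmom m) & angmom m != 0]].

Definition eq_mod2pi (R : realType) (s t : R) : Prop :=
  exists n : int, s = t + 2 * pi * n%:~R.

(* An angle defined modulo 2 pi is a function [phi] whose choice of
   representatives is irrelevant, and possibly discontinuous; [theta] is a
   smooth determination of it near [m]. *)
Definition angle_lift (R : realType) (phi theta : phase R -> R) (m : phase R)
    : Prop :=
  smooth_at theta m /\
  \forall x \near m, TS2 x -> eq_mod2pi (phi x) (theta x).

(* [D] is a subset of [TS2]. The second clause says that [(A, phi mod 2 pi)]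
   maps [D] bijectively onto [V * (R / 2 pi Z)^2], where [V] is the set of
   values of the actions on [D]. *)
Record action_angle_coordinates (R : realType) (D : set (phase R))
    (A phi : 'I_2 -> phase R -> R) : Prop := ActionAngleCoordinates {
  actions_smooth : forall k m, D m -> smooth_at (A k) m ;
  actions_angles_bij : forall m (t : 'I_2 -> R), D m ->
    exists! m', [/\ D m', forall k, A k m' = A k m &
                    forall k, eq_mod2pi (phi k m') (t k)] ;
  angles_conjugate : forall m, D m ->
    exists theta : 'I_2 -> phase R -> R,
      (forall k, angle_lift (phi k) (theta k) m) /\
      (forall u v, tangent m u -> tangent m v ->
        omega u v = \sum_k wedge (mdiff (A k) m) (mdiff (theta k) m) u v) }.

Definition expNi (R : realType) (phi : phase R -> R) (x : phase R) : R[i] :=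
  cexp (- 'i%C * (phi x)%:C).

(* Main.v *)
(* Near a point of the domain, [expNi (phi k)] only depends on a smooth
   determination [theta k] of the angle, so its differential along tangent
   vectors is a multiple of [d theta_k].  Since
   [omega = sum_k dA_k /\ dtheta_k] is nondegenerate on the tangent space, the
   four differentials form a basis of its dual, and pairing the equation of the
   Hamiltonian vector field [X_h] with the dual basis gives
   [dA_k(X_h) = - dh/dtheta_k] and [dtheta_k(X_h) = dh/dA_k].
   That [mdiff] does not depend on the extension follows by differentiating
   along curves contained in [TS2]. *)
Require Import Defs.
From mathcomp Require Import all_boot all_order all_algebra.
From mathcomp Require Import all_classical all_reals all_analysis.
From mathcomp Require Import ring.
Set Implicit Arguments.
Unset Strict Implicit.
Unset Printing Implicit Defensive.
Import Order.TTheory GRing.Theory Num.Theory numFieldNormedType.Exports.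
Local Open Scope ring_scope.
Local Open Scope complex_scope.

(** * Coordinate forms of the scalar product and of the symplectic form *)

Lemma dotE (R : realType) (u v : 'rV[R]_3) :
  dot u v = u 0 i1 * v 0 i1 + u 0 i2 * v 0 i2 + u 0 i3 * v 0 i3.
Proof.
rewrite /dot !big_ord_recl big_ord0 addr0 addrA.
by congr (u _ _ * v _ _ + u _ _ * v _ _ + u _ _ * v _ _); apply/val_inj.
Qed.

Lemma omegaE (R : realType) (u v : phase R) :
  omega u v = dot u.2 v.1 - dot v.2 u.1.
Proof. by rewrite /omega /wedge /dot sumrB. Qed.

(** * Curves in [TS2] and the intrinsic differential *)

Lemma is_derive_scalel (R : realType) (V : normedModType R) (f : R -> R)
    (df : R) (w : V) (x : R) :
  is_derive x 1 f df -> is_derive x 1 (fun t => f t *: w) (df *: w).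
Proof.
move=> hf; have fd : differentiable f x by apply/derivable1_diffP; case: hf.
have fwd := differentiableZl w fd.
apply: DeriveDef; first exact: diff_derivable.
rewrite (deriveE _ fwd) diffZl// -deriveE//; by case: hf => _ ->.
Qed.

(* Stereographic parametrisation of a circle through [m.1], so that no square
   root is needed, and projection of the momentum onto the tangent plane. *)
Lemma TS2_curve (R : realType) (m v : phase R) : TS2 m -> tangent m v ->
  exists c : R -> phase R,
    [/\ forall t, TS2 (c t), c 0 = m & is_derive (0 : R) 1 c v].
Proof.
case: m v => q p [v1 v2] [/= qq qp] [/= qv pv].
(* Below, [al] is (1 - a t^2)/(1 + a t^2) and [be] is t/(1 + a t^2). Since |v1|^2 = 4 a and v1 is
   orthogonal to q, the point al q + be v1 has squared norm al^2 + 4 a be^2 = 1 for every t. *)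
pose a : R := dot v1 v1 / 4.
have a0 : 0 <= a.
  by rewrite divr_ge0// sumr_ge0// => i _; rewrite -expr2 sqr_ge0.
pose D : R -> R := cst 1 + cst a * (id * id).
have D0 t : D t != 0.
  by rewrite gt_eqF// ltr_wpDr// mulr_ge0// -expr2 sqr_ge0.
have dD : is_derive (0 : R) 1 D 0.
  have dI := is_derive_id (0 : R) (1 : R).
  have H := is_deriveD (is_derive_cst (1 : R) (0 : R) 1)
    (is_deriveM (is_derive_cst a (0 : R) 1) (is_deriveM dI dI)).
  by apply: (is_derive_eq H); rewrite /GRing.scale/=; ring.
pose Dv (t : R) := (D t)^-1.
have dV : is_derive (0 : R) 1 Dv 0.
  apply: DeriveDef; first by apply: derivableV => //; case: dD.
  by rewrite deriveV//; case: dD => _ ->; rewrite scaler0.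
have V0 : Dv 0 = 1 by rewrite /Dv /D !fctE mulr0 mulr0 addr0 invr1.
pose al : R -> R := cst 2 * Dv - cst 1.
pose be : R -> R := id * Dv.
have al0 : al 0 = 1 by rewrite /al !fctE V0; ring.
have be0 : be 0 = 0 by rewrite /be !fctE mul0r.
have dal : is_derive (0 : R) 1 al 0.
  by apply: is_derive_eq; rewrite /GRing.scale/=; ring.
have dbe : is_derive (0 : R) 1 be 1.
  by apply: is_derive_eq; rewrite V0 /GRing.scale/=; ring.
(* [g] is the radial component of p + t v2 at the moving base point, simplified by <q, p> = 0. Its
   derivative at 0 is <q, v2> + <v1, p>, which vanishes by the second tangency equation; removing it
   therefore keeps the velocity v2. *)
pose g : R -> R := al * (id * cst (dot q v2)) +
                   be * (cst (dot v1 p) + id * cst (dot v1 v2)).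
have g0 : g 0 = 0 by rewrite /g !fctE be0; ring.
have dg : is_derive (0 : R) 1 g 0.
  have dM (h : R) : is_derive (0 : R) 1 (id * cst h) h.
    have H := is_deriveM (is_derive_id (0 : R) (1 : R)) (is_derive_cst h _ _).
    by apply: (is_derive_eq H); rewrite /GRing.scale/=; ring.
  have H := is_deriveD (is_deriveM dal (dM (dot q v2)))
   (is_deriveM dbe (is_deriveD (is_derive_cst (dot v1 p) _ _) (dM (dot v1 v2)))).
  apply: (is_derive_eq H); rewrite !fctE al0 be0 /GRing.scale/= -[RHS]pv; ring.
(* Each term is a scalar function times a fixed vector, so the derivative can be taken term by
   term. *)
pose c (t : R) : phase R :=
  al t *: ((q, 0) : phase R) + be t *: ((v1, 0) : phase R)
  + ((0, p) : phase R) + t *: ((0, v2) : phase R)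
  - (g * al) t *: ((0, q) : phase R) - (g * be) t *: ((0, v1) : phase R).
exists c; split.
- move=> t; rewrite /TS2 /c /=.
  have cq : dot (al t *: q + be t *: v1) (al t *: q + be t *: v1) = 1.
    have -> : dot (al t *: q + be t *: v1) (al t *: q + be t *: v1) =
      al t ^+ 2 * dot q q + 2 * al t * be t * dot q v1 + be t ^+ 2 * dot v1 v1.
      by rewrite !dotE !mxE; ring.
    have -> : dot v1 v1 = 4 * a by rewrite /a; field.
    have := D0 t.
    rewrite qq qv /al /be /Dv /D !fctE => h.
    by field.
  split.
    by rewrite !(scaler0, addr0, oppr0).
  rewrite !(scaler0, addr0, add0r, oppr0).
  have -> : dot (al t *: q + be t *: v1)
      (p + t *: v2 - (g * al) t *: q - (g * be) t *: v1) =
     al t * (dot q p + t * dot q v2) + be t * (dot v1 p + t * dot v1 v2)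
     - g t * dot (al t *: q + be t *: v1) (al t *: q + be t *: v1).
    by rewrite !dotE !fctE !mxE; ring.
  by rewrite cq qp /g !fctE; ring.
- rewrite /c !fctE al0 be0 g0 !mul0r !scale0r scale1r !subr0 !addr0.
  by congr pair; rewrite /= (addr0, add0r).
- have S (f : R -> R) (df : R) (w : phase R) : is_derive (0 : R) 1 f df ->
      is_derive (0 : R) 1 (fun t => f t *: w) (df *: w).
    exact: is_derive_scalel.
  have H := is_deriveB (is_deriveB (is_deriveD (is_deriveD (is_deriveD
    (S _ _ (q, 0) dal) (S _ _ (v1, 0) dbe))
    (is_derive_cst ((0, p) : phase R) _ _))
    (S _ _ (0, v2) (is_derive_id _ _))) (S _ _ (0, q) (is_deriveM dg dal)))
    (S _ _ (0, v1) (is_deriveM dg dbe)).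
  apply: (@is_derive_eq _ _ _ c _ _ _ _ H).
  rewrite g0 al0 be0 !scaler0 !addr0 scale0r scale1r.
  rewrite !(scale0r, scale1r, subr0) add0r.
  by congr pair; rewrite /= (addr0, add0r).
Qed.

(** Two extensions agree along a curve in [TS2] with velocity [v], so by the chain rule their
    differentials agree on [v]. The extension picked by [xget] can thus be traded for any convenient
    one. *)
Lemma mdiffE (R : realType) (f F : phase R -> R) (m v : phase R) :
  TS2 m -> extension_at f m F -> tangent m v -> mdiff f m v = 'd F m v.
Proof.
move=> hm hF hv; have [c [cTS c0 dc]] := TS2_curve hm hv.
have cdiff : differentiable c 0 by apply/derivable1_diffP; case: dc.
have along G : differentiable G m -> 'D_1 (G \o c) 0 = 'd G m v.
  rewrite -c0 => Gd; rewrite deriveE; last exact: differentiable_comp.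
  by rewrite diff_comp//= -(deriveE _ cdiff); case: dc => _ ->.
have ext G : extension_at f m G -> \forall t \near (0 : R), G (c t) = f (c t).
  move=> [_]; rewrite -{1}c0 => hG.
  have ncG : nbhs (0 : R) (fun t => TS2 (c t) -> G (c t) = f (c t)) :=
    differentiable_continuous cdiff hG.
  by near=> t; apply: (near ncG t).
rewrite /mdiff; case: xgetP => [G _ hG|/(_ _ hF)//].
rewrite -(along _ _ hF.1) -(along _ _ hG.1).
apply: near_eq_derive => //; near=> t => /=.
by rewrite (near (ext _ hG) t) ?(near (ext _ hF) t).
Unshelve. all: by end_near. Qed.

Lemma smooth_at_extension (R : realType) (f : phase R -> R) (m : phase R) :
  smooth_at f m -> exists F, extension_at f m F.
Proof.
move=> [U [F [oU Um ckF UF]]]; exists F; split; first exact: (ckF 1%N).1.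
by apply: filterS (open_nbhs_nbhs (conj oU Um)) => x; apply: UF.
Qed.

Lemma mdiff_cst (R : realType) (a : R) (m v : phase R) :
  TS2 m -> tangent m v -> mdiff (fun=> a) m v = 0.
Proof.
move=> hm hv; rewrite (mdiffE (F := cst a) hm _ hv) ?diff_cst//.
by split; [exact: differentiable_cst|near=> x].
Unshelve. all: by end_near. Qed.

(** Chain rule. Asking for the identity only near [m] on [TS2] lets [f] be a smooth determination of
    an angle while [h] is built from the possibly discontinuous angle itself. *)
Lemma mdiff_comp (R : realType) (g : R -> R) (dg : R) (f h : phase R -> R)
    (m v : phase R) :
  TS2 m -> smooth_at f m -> is_derive (f m) 1 g dg ->
  (\forall x \near m, TS2 x -> h x = g (f x)) -> tangent m v ->
  mdiff h m v = dg * mdiff f m v.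
Proof.
move=> hm /smooth_at_extension[F hF] g'f hgf hv.
have Fm : F m = f m by apply: (nbhs_singleton hF.2).
have gd : differentiable g (F m).
  by apply/derivable1_diffP; rewrite Fm; case: g'f.
rewrite (mdiffE hm hF hv) (mdiffE (F := g \o F) hm _ hv); last first.
  split; first by apply: differentiable_comp => //; case: hF.
  near=> x => hx /=; rewrite (near hgf x)//; congr g.
  exact: (near hF.2 x).
rewrite diff_comp//=; last by case: hF.
rewrite deriv1E; last exact/derivable1_diffP.
by rewrite /GRing.scale/= derive1E Fm mulrC; case: g'f => _ ->.
Unshelve. all: by end_near. Qed.

(** * Angles modulo 2 pi and their exponentials *)

Lemma angle_lift_at (R : realType) (phi theta : phase R -> R) (m : phase R) :
  TS2 m -> angle_lift phi theta m -> eq_mod2pi (phi m) (theta m).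
Proof. by move=> hm [_ /nbhs_singleton]; apply. Qed.

Lemma periodicz (U V : zmodType) (f : U -> V) (T : U) :
  periodic f T -> forall (n : int) a, f (a + T *~ n) = f a.
Proof.
move=> pf [] n a; first by rewrite -pmulrn periodicn.
by rewrite NegzE mulrNz -pmulrn -(periodicn pf n.+1) subrK.
Qed.

Lemma cos_eq_mod2pi (R : realType) (s t : R) : eq_mod2pi s t -> cos s = cos t.
Proof.
move=> [n ->]; by rewrite mulrzr mulr_natl (periodicz (@cosD2pi R)).
Qed.

Lemma sin_eq_mod2pi (R : realType) (s t : R) : eq_mod2pi s t -> sin s = sin t.
Proof.
move=> [n ->]; by rewrite mulrzr mulr_natl (periodicz (@sinD2pi R)).
Qed.

Lemma expNiE (R : realType) (phi : phase R -> R) (x : phase R) :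
  expNi phi x = cos (phi x) -i* sin (phi x).
Proof.
rewrite /expNi /cexp /=; simpc.
by rewrite expR0 !mul1r cosN sinN.
Qed.

(** * Linear algebra of the tangent space *)

Lemma mdiff_sum (R : realType) (f : phase R -> R) (m : phase R) (n : nat)
    (x : 'I_n -> R) (e : 'I_n -> phase R) :
  mdiff f m (\sum_i x i *: e i) = \sum_i x i * mdiff f m (e i).
Proof. by rewrite /mdiff linear_sum; apply: eq_bigr => i _; rewrite linearZ. Qed.

Lemma tangent_sum (R : realType) (m : phase R) (n : nat)
    (x : 'I_n -> R) (e : 'I_n -> phase R) :
  (forall i, tangent m (e i)) -> tangent m (\sum_i x i *: e i).
Proof.
move=> he; elim/big_ind: _ => [|u v [u1 u2] [v1 v2]|i _].
- by split; rewrite /= !dotE !mxE; ring.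
- split.
    by rewrite -[RHS]addr0 -{1}u1 -v1 !dotE /= !mxE; ring.
  by rewrite -[RHS]addr0 -{1}u2 -v2 !dotE /= !mxE; ring.
have [e1 e2] := he i; split.
  by rewrite -[RHS](mulr0 (x i)) -e1 !dotE /= !mxE; ring.
by rewrite -[RHS](mulr0 (x i)) -e2 !dotE /= !mxE; ring.
Qed.

(* [m.1], [m.2] and [m.1 x m.2] are orthogonal, which gives a Darboux basis of
   the tangent space without choosing an orthonormal frame. *)
Lemma darboux_frame (R : realType) (m : phase R) : TS2 m -> m.2 != 0 ->
  exists e : 'I_(2 + 2) -> phase R,
    (forall i, tangent m (e i)) /\
    \matrix_(i, j) omega (e i) (e j) = block_mx 0 1%:M (- 1%:M) 0.
Proof.
case: m => q p [/= qq qp] p0.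
set s := dot p p.
have s0 : s != 0.
  apply: contra_neq p0 => s0; apply/rowP => i; rewrite mxE.
  have pp0 k : 0 <= p 0 k * p 0 k by rewrite -expr2 sqr_ge0.
  have /eqP := psumr_eq0P (fun k _ => pp0 k) s0 (i := i) isT.
  by rewrite mulf_eq0 orbb => /eqP.
(* The cross product of q and p; Lagrange's identity gives it the same squared norm [s] as p. *)
pose b : 'rV[R]_3 := \row_i [:: q 0 i2 * p 0 i3 - q 0 i3 * p 0 i2;
  q 0 i3 * p 0 i1 - q 0 i1 * p 0 i3; q 0 i1 * p 0 i2 - q 0 i2 * p 0 i1]`_i.
have qb : dot q b = 0 by rewrite dotE !mxE /=; ring.
have bp : dot b p = 0 by rewrite dotE !mxE /=; ring.
have bb : dot b b = s.
  transitivity (dot q q * dot p p - dot q p ^+ 2).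
    by rewrite !dotE !mxE /=; ring.
  by rewrite qq qp /s; ring.
pose a (k : 'I_2) : 'rV[R]_3 := if k == 0 then p else b.
have qa k : dot q (a k) = 0 by rewrite /a; case: ifP.
have ab k l : dot (a k) (a l) = s * (k == l)%:R.
  have pb : dot p b = 0 by rewrite -bp !dotE; ring.
  rewrite /a; case: (unliftP 0 k) => [k' ->|->];
    case: (unliftP 0 l) => [l' ->|->];
    rewrite ?(ord1 k') ?(ord1 l') ?eqxx /= ?mulr1 ?mulr0//.
(* The multiple of q corrects the momentum part so that the vector is tangent; the factor -1/s
   normalises the pairing of the two halves to 1. *)
pose e (i : 'I_(2 + 2)) : phase R := match fintype.split i with
  | inl k => (a k, - dot (a k) p *: q) | inr k => (0, - s^-1 *: a k) end.
have dZr x (u v : 'rV[R]_3) : dot u (x *: v) = x * dot u v.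
  by rewrite !dotE !mxE; ring.
have dZl x (u v : 'rV[R]_3) : dot (x *: u) v = x * dot u v.
  by rewrite !dotE !mxE; ring.
have d0 (v : 'rV[R]_3) : dot v 0 = 0 by rewrite !dotE !mxE; ring.
have d0r (v : 'rV[R]_3) : dot 0 v = 0 by rewrite !dotE !mxE; ring.
exists e; split.
  move=> i; rewrite /e; case: fintype.split => k; split => /=.
  - exact: qa.
  - by rewrite dZr qq; ring.
  - exact: d0.
  - by rewrite dZr qa d0r; ring.
have el k : e (lshift 2 k) = (a k, - dot (a k) p *: q).
  by rewrite /e (unsplitK (inl k)).
have er k : e (rshift 2 k) = (0, - s^-1 *: a k).
  by rewrite /e (unsplitK (inr k)).
apply/matrixP => i j; rewrite mxE omegaE.
case: (split_ordP i) => k ->; case: (split_ordP j) => l ->; rewrite ?el ?er /=.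
- by rewrite block_mxEul !dZl !qa mxE; ring.
- by rewrite block_mxEur d0 dZl ab mxE eq_sym; field.
- by rewrite block_mxEdl d0 dZl ab !mxE; field.
- by rewrite block_mxEdr !d0 mxE subrr.
Qed.

Definition conjugate_at (R : realType) (m : phase R)
    (A theta : 'I_2 -> phase R -> R) : Prop :=
  forall u v, tangent m u -> tangent m v ->
    omega u v = \sum_k wedge (mdiff (A k) m) (mdiff (theta k) m) u v.

(* The form is nondegenerate on the 4-dimensional tangent space, so the four
   differentials are a basis of its dual. *)
Lemma conjugate_surj (R : realType) (m : phase R)
    (A theta : 'I_2 -> phase R -> R) (a b : 'I_2 -> R) :
  TS2 m -> m.2 != 0 -> conjugate_at m A theta ->
  exists v, [/\ tangent m v, forall k, mdiff (A k) m v = a k &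
                forall k, mdiff (theta k) m v = b k].
Proof.
move=> hm p0 conj; have [e [te eO]] := darboux_frame hm p0.
pose MA : 'M[R]_(2, 2 + 2) := \matrix_(k, j) mdiff (A k) m (e j).
pose MT : 'M[R]_(2, 2 + 2) := \matrix_(k, j) mdiff (theta k) m (e j).
(* Conjugacy evaluated on the frame: MA^T MT - MT^T MA is the standard symplectic matrix J. *)
have OE : row_mx MA^T (- MT^T) *m col_mx MT MA = block_mx 0 1%:M (- 1%:M) 0.
  rewrite -eO mul_row_col mulNmx; apply/matrixP => i j.
  rewrite !mxE conj// /wedge sumrB; congr (_ - _).
    by apply: eq_bigr => k _; rewrite !mxE.
  by apply: eq_bigr => k _; rewrite !mxE mulrC.
(* As J^2 = -1, multiplying by -J gives a left inverse of the square matrix of the four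
   differentials, hence also a right inverse. *)
pose N := - block_mx 0 1%:M (- 1%:M) 0 *m row_mx MA^T (- MT^T).
have : N *m col_mx MT MA = 1%:M.
  rewrite -mulmxA OE mulNmx mulmx_block !mul0mx !mulmx0 !add0r !addr0 mul1mx.
  rewrite mulmx1.
  by rewrite opp_block_mx !opprK !oppr0 -scalar_mx_block.
move=> /mulmx1C MN.
have [w [Tw Aw]] : exists w, MT *m w = \col_k b k /\ MA *m w = \col_k a k.
  exists (N *m col_mx (\col_k b k) (\col_k a k)); apply: eq_col_mx.
  by rewrite -mul_col_mx mulmxA MN mul1mx.
exists (\sum_i w i 0 *: e i); split=> [|k|k]; first exact: tangent_sum.
  rewrite mdiff_sum; have := congr1 (fun M : 'cV_2 => M k 0) Aw.
  by rewrite !mxE => <-; apply: eq_bigr => i _; rewrite !mxE mulrC.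
rewrite mdiff_sum; have := congr1 (fun M : 'cV_2 => M k 0) Tw.
by rewrite !mxE => <-; apply: eq_bigr => i _; rewrite !mxE mulrC.
Qed.

(** * Hamiltonian vector fields in action-angle terms *)

Lemma hamvec_conjugate (R : realType) (m : phase R)
    (A theta : 'I_2 -> phase R -> R) (h : phase R -> R) (a b : 'I_2 -> R) :
  TS2 m -> m.2 != 0 -> conjugate_at m A theta ->
  (forall v, tangent m v -> mdiff h m v =
     \sum_k (a k * mdiff (A k) m v + b k * mdiff (theta k) m v)) ->
  [/\ tangent m (hamvec h m),
      forall k, mdiff (A k) m (hamvec h m) = - b k &
      forall k, mdiff (theta k) m (hamvec h m) = a k].
Proof.
move=> hm p0 conj dh.
(* An explicit solution of the Hamiltonian equation, which excludes the default value 0 of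
   [xget]. *)
have [X [tX XA XT]] := conjugate_surj (fun k => - b k) a hm p0 conj.
have hX v : tangent m v -> omega X v = - mdiff h m v.
  move=> tv; rewrite conj// dh// -sumrN; apply: eq_bigr => l _.
  rewrite /wedge XA XT.
  by move: (mdiff (theta l) m v) (mdiff (A l) m v) => x y; ring.
rewrite /hamvec; case: xgetP => [Y _ [tY Yh]|/(_ X (Logic.conj tX hX))//].
have sumd (x : 'I_2 -> R) k : \sum_l x l * (l == k)%:R = x k.
  rewrite (bigD1 k)//= eqxx mulr1 big1 ?addr0// => l /negPf->.
  by rewrite mulr0.
(* The chosen field [Y] is paired with a tangent vector of prescribed components x, y; taking unit
   vectors for x or y then isolates each component of [Y]. *)
have pair_with (x y : 'I_2 -> R) :
  \sum_k (mdiff (A k) m Y * y k - x k * mdiff (theta k) m Y) =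
    - \sum_k (a k * x k + b k * y k).
  have [v [tv vA vT]] := conjugate_surj x y hm p0 conj.
  transitivity (omega Y v).
    by rewrite conj//; apply: eq_bigr => k _; rewrite /wedge vA vT.
  rewrite Yh// dh//; congr (- _).
  by apply: eq_bigr => k _; rewrite vA vT.
split=> // k.
- have := pair_with (fun=> 0) (fun l => (l == k)%:R).
  under eq_bigr do rewrite mul0r subr0.
  by under [in RHS]eq_bigr do rewrite mulr0 add0r; rewrite !sumd.
- have := pair_with (fun l => (l == k)%:R) (fun=> 0).
  under eq_bigr do rewrite mulr0 sub0r mulrC.
  under [in RHS]eq_bigr do rewrite mulr0 addr0.
  by rewrite sumrN !sumd => /oppr_inj.
Qed.

(** To be applied to the real and imaginary parts of [expNi (phi k)], whose differentials are
    multiples of that of [theta k]. *)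
Lemma hamvec_angle (R : realType) (m : phase R) (A theta : 'I_2 -> phase R -> R)
    (h : phase R -> R) (k : 'I_2) (r : R) :
  TS2 m -> m.2 != 0 -> conjugate_at m A theta ->
  (forall v, tangent m v -> mdiff h m v = r * mdiff (theta k) m v) ->
  [/\ tangent m (hamvec h m),
      forall j, mdiff (A j) m (hamvec h m) = - (r * (j == k)%:R) &
      forall j, mdiff (theta j) m (hamvec h m) = 0].
Proof.
move=> hm p0 conj dh.
apply: (hamvec_conjugate (a := fun=> 0) (b := fun j => r * (j == k)%:R)) => //.
move=> v tv.
rewrite dh// (bigD1 k)//= big1 => [|l /negPf->]; last first.
  by rewrite !(mulr0, mul0r) addr0.
by rewrite eqxx mul0r add0r mulr1 addr0.
Qed.

Lemma hamvec_action (R : realType) (m : phase R)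
    (A theta : 'I_2 -> phase R -> R) (k : 'I_2) :
  TS2 m -> m.2 != 0 -> conjugate_at m A theta ->
  forall j, mdiff (A j) m (hamvec (A k) m) = 0.
Proof.
move=> hm p0 conj j.
have [//|_ -> _] := hamvec_conjugate (h := A k) (a := fun j => (j == k)%:R)
  (b := fun=> 0) hm p0 conj; last by rewrite oppr0.
move=> v tv; rewrite (bigD1 k)//= big1 => [|l /negPf->]; last first.
  by rewrite !(mulr0, mul0r) addr0.
by rewrite eqxx mul1r mul0r !addr0.
Qed.

(** * Differentials of the exponentials and the brackets *)

Lemma mdiff_cos_angle (R : realType) (phi theta : phase R -> R)
    (m v : phase R) :
  TS2 m -> angle_lift phi theta m -> tangent m v ->
  mdiff (fun x => complex.Re (expNi phi x)) m v =
  - sin (phi m) * mdiff theta m v.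
Proof.
move=> hm lift hv; rewrite (sin_eq_mod2pi (angle_lift_at hm lift)).
case: lift => sm near_phi; apply: (mdiff_comp hm sm (is_derive_cos _)) => //.
(* Near [m] on [TS2] the two angles differ by multiples of 2 pi, so their cosines coincide. *)
apply: filterS near_phi => x + hx => /(_ hx) /cos_eq_mod2pi <-.
by rewrite expNiE.
Qed.

Lemma mdiff_sin_angle (R : realType) (phi theta : phase R -> R)
    (m v : phase R) :
  TS2 m -> angle_lift phi theta m -> tangent m v ->
  mdiff (fun x => complex.Im (expNi phi x)) m v =
  - cos (phi m) * mdiff theta m v.
Proof.
move=> hm lift hv; rewrite (cos_eq_mod2pi (angle_lift_at hm lift)).
case: lift => sm near_phi.
have dsin : is_derive (theta m) 1 (fun t => - sin t) (- cos (theta m)).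
  exact: is_deriveN.
apply: (mdiff_comp hm sm dsin) => //.
apply: filterS near_phi => x + hx => /(_ hx) /sin_eq_mod2pi <-.
by rewrite expNiE.
Qed.

Lemma cbracketE (R : realType) (f g : phase R -> R[i]) (m : phase R)
    (rr ii ri ir : R) :
  bracket (fun x => complex.Re (f x)) (fun x => complex.Re (g x)) m = rr ->
  bracket (fun x => complex.Im (f x)) (fun x => complex.Im (g x)) m = ii ->
  bracket (fun x => complex.Re (f x)) (fun x => complex.Im (g x)) m = ri ->
  bracket (fun x => complex.Im (f x)) (fun x => complex.Re (g x)) m = ir ->
  cbracket f g m = (rr - ii) +i* (ri + ir).
Proof. by move=> <- <- <- <-. Qed.

Theorem proposition3p6 (R : realType) (phi : 'I_2 -> phase R -> R)
    (hphi : action_angle_coordinates (@domain R) (@action R) phi)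
    (m : phase R) (hm : @domain R m) (j k : 'I_2) :
  [/\ bracket (action j) (action k) m = 0,
      cbracket (expNi (phi j)) (expNi (phi k)) m = 0 &
      cbracket (fun x => (action j x)%:C) (expNi (phi k)) m
        = 'i%C * expNi (phi k) m * (j == k)%:R].
Proof.
have [theta [lift conj]] := angles_conjugate hphi hm.
have [tm _ L0] := hm.
(* Nonzero angular momentum forces nonzero momentum, as the Darboux frame requires. *)
have p0 : m.2 != 0.
  by apply: contra_neq L0 => p0; rewrite /angmom p0 !mxE; ring.
have [tr rA rT] :=
  hamvec_angle tm p0 conj (fun v => mdiff_cos_angle tm (lift k)).
have [ti iA iT] :=
  hamvec_angle tm p0 conj (fun v => mdiff_sin_angle tm (lift k)).
split; first exact: hamvec_action tm p0 conj _.
(* The Hamiltonian fields of cos phi_k and -sin phi_k annihilate every dtheta_j, so all four real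
   brackets vanish. *)
- have rr := etrans (mdiff_cos_angle tm (lift j) tr) (congr1 _ (rT j)).
  have ri := etrans (mdiff_cos_angle tm (lift j) ti) (congr1 _ (iT j)).
  have ir := etrans (mdiff_sin_angle tm (lift j) tr) (congr1 _ (rT j)).
  have ii := etrans (mdiff_sin_angle tm (lift j) ti) (congr1 _ (iT j)).
  by rewrite (cbracketE rr ii ri ir) !mulr0 subr0 addr0.
(* The action has imaginary part 0. The two remaining brackets combine, for j = k, to sin phi_k + i
   cos phi_k, which is i times the exponential of -i phi_k. *)
- have c0 v : tangent m v -> mdiff (fun=> 0) m v = 0 by exact: mdiff_cst.
  have -> := cbracketE (f := fun x => (action j x)%:C)
    (rA j) (c0 _ ti) (iA j) (c0 _ tr).
  rewrite expNiE subr0 addr0.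
  by case: (j == k); simpc; rewrite ?mulr1 ?mulr0 ?opprK ?oppr0.
Qed.
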